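(* Suppose that $Z^TQZ$ is indefinite and that $\mathcal J$ is a set of quadratic functions $f_j(x)=x^TS_jx+s_j^Tx+\eta_j$, with $S_j\in\mathbb S^n$, $s_j\in\mathbb R^n$, $\eta_j\in\mathbb R$, such that $f_j(x)=0$ for all $x\in\Omega:=\{x\in\mathbb R^n:Ax=b\}$. Let $\alpha_z=-\lambda_{\min}(Z^TQZ)$. Denote by $\mu_{\mathrm{EIGZ}}$ the optimal objective function value of $$\min_{x\in\mathcal X}\ x^TQ_{\alpha_z}x+q_{\alpha_z}^Tx+k_{\alpha_z},$$ and by $\mu_{\mathrm{EIGJ}}$ the optimal objective function value of $$\max_{\alpha\in\mathbb R_{\ge0},\ \beta\in\mathbb R^{|\mathcal J|}:\ Q_{\alpha,\beta}\succcurlyeq0}\ \Big\{\min_{x\in\mathcal X}\ x^TQ_\alpha x+q_\alpha^Tx+k_\alpha\Big\},$$ where $Q_\alpha=Q+\alpha I_n$, $Q_{\alpha,\beta}=Q_\alpha+\sum_{j\in\mathcal J}\beta_jS_j$, $q_\alpha=q-\alpha(l+u)$ and $k_\alpha=\alpha\,l^Tu$. Then $\mu_{\mathrm{EIGJ}}\le\mu_{\mathrm{EIGZ}}$.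
   Context: $Q\in\mathbb R^{n\times n}$ is symmetric, $q\in\mathbb R^n$, and $\mathcal X=\{x\in\mathbb R^n: Ax=b,\ Cx\le d,\ l\le x\le u\}$ with $A\in\mathbb R^{m\times n}$, $b\in\mathbb R^m$, $C\in\mathbb R^{p\times n}$, $d\in\mathbb R^p$, and finite bounds $-\infty<l_i<u_i<\infty$ for all $i$. $Z$ is a matrix whose columns form an orthonormal basis of the nullspace of $A$. $\mathbb S^n$ is the set of real symmetric $n\times n$ matrices, $M\succcurlyeq0$ means positive semidefinite, $I_n$ is the identity, $\lambda_{\min}(M)$ is the smallest eigenvalue of a symmetric matrix $M$. The set $\mathcal J$ is finite and is also used as its own index set. The optimal value of the outer maximization is understood as a supremum (it need not be attained). It is assumed (without loss of generality, by a known characterization of quadratic functions vanishing on $\Omega$) that $S_j=A^TW_j^T+W_jA$ for some $W_j\in\mathbb R^{n\times m}$, $j\in\mathcal J$. *)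

(* Defs.v *)
From HB Require Import structures.
From mathcomp Require Import all_boot all_order all_algebra.
From mathcomp Require Import boolp classical_sets reals ereal.
From mathcomp Require Import complex.

Set Implicit Arguments.
Unset Strict Implicit.
Unset Printing Implicit Defensive.
Import Order.TTheory GRing.Theory Num.Theory.
Local Open Scope classical_set_scope.
Local Open Scope ring_scope.

(* Vectors are columns, so that (x^T *m y) 0 0 is the inner product. *)
Definition dotv (R : realType) (n : nat) (x y : 'cV[R]_n) : R :=
  (x^T *m y) 0 0.

Definition qform (R : realType) (n : nat) (M : 'M[R]_n) (x : 'cV[R]_n) : R :=
  (x^T *m M *m x) 0 0.

Definition quadfun (R : realType) (n : nat) (M : 'M[R]_n) (c : 'cV[R]_n)
    (k : R) (x : 'cV[R]_n) : R :=
  qform M x + dotv c x + k.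

Definition psdmx (R : realType) (n : nat) (M : 'M[R]_n) : Prop :=
  M^T = M /\ forall x : 'cV[R]_n, 0 <= qform M x.

Definition indefinitemx (R : realType) (n : nat) (M : 'M[R]_n) : Prop :=
  (exists x : 'cV[R]_n, 0 < qform M x) /\ (exists y : 'cV[R]_n, qform M y < 0).

(* For symmetric M of positive size the infimum is the smallest eigenvalue:
   see lambda_min_is_min. *)
Definition lambda_min (R : realType) (n : nat) (M : 'M[R]_n) : R :=
  inf [set a | eigenvalue M a].

Lemma symmetric_eigenvalue_ex (R : rcfType) (n : nat) (M : 'M[R]_n) :
  (0 < n)%N -> M^T = M -> exists a, eigenvalue M a.
Proof.
move=> n_gt0 symM; pose f : {rmorphism R -> R[i]} := real_complex R.
have [c /eigenvalueP[v vM v0]] := eigenvalue_closed (map_mx f M) n_gt0.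
have /(congr1 (fun B : 'M_1 => B 0 0)) :
    v *m map_mx f M *m (map_mx Num.conj v)^T
      = (map_mx Num.conj (v *m map_mx f M) *m v^T)^T.
  rewrite trmx_mul trmxK map_mxM trmx_mul -map_mx_comp (_ : map_mx (_ \o f) M = map_mx f M).
    by rewrite [(map_mx f M)^T]map_trmx symM mulmxA.
  by apply/matrixP => i j; rewrite !mxE /=; simpc.
rewrite vM map_mxZ -!scalemxAl linearZ /= trmx_mul trmxK mxE [RHS]mxE => e.
have nz : (v *m (map_mx Num.conj v)^T) 0 0 != 0.
  rewrite mxE psumr_eq0; last by move=> j _; rewrite !mxE mul_conjC_ge0.
  apply: contra v0 => /allP v0; apply/eqP/rowP => j.
  by have := v0 j (mem_index_enum _); rewrite !mxE mul_conjC_eq0 => /eqP.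
have /CrealP/Creal_ImP cR : Num.conj c = c by apply: (mulIf nz).
have cE : c = f (complex.Re c).
  by move: cR; case: (c) => a b; rewrite /f /=; rewrite -complexIm /= => -[->].
exists (complex.Re c); rewrite -(eigenvalue_map f) -cE.
by apply/eigenvalueP; exists v.
Qed.

Lemma lambda_min_is_min (R : realType) (n : nat) (M : 'M[R]_n) :
  (0 < n)%N -> M^T = M ->
  eigenvalue M (lambda_min M) /\ forall a, eigenvalue M a -> lambda_min M <= a.
Proof.
move=> n_gt0 symM; have [a0 ea0] := symmetric_eigenvalue_ex n_gt0 symM.
have cp0 : char_poly M != 0 by rewrite monic_neq0 // char_poly_monic.
have [a ea amin] : exists2 a, eigenvalue M a & forall b, eigenvalue M b -> a <= b.
  pose P k := `[< exists s : seq R, [/\ uniq s, all (root (char_poly M)) s & size s = k] >].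
  have Pex : exists k, P k by exists 0%N; apply/asboolP; exists [::].
  have Pub k : P k -> (k <= size (char_poly M))%N.
    by move=> /asboolP[s [us rs <-]]; apply: ltnW; apply: max_poly_roots.
  have [k /asboolP[s [us rs ks]] kmax] := ex_maxnP Pex Pub.
  have sP b : eigenvalue M b -> b \in s.
    rewrite eigenvalue_root_char => rb; apply: contraT => bs.
    suff /kmax : P k.+1 by rewrite ltnn.
    by apply/asboolP; exists (b :: s); split; rewrite /= ?bs ?rb ?ks.
  have a0s := sP _ ea0.
  pose i := [arg min_(i < Ordinal (etrans (index_mem a0 s) a0s)) s`_i : R]%O.
  exists (s`_i); first by rewrite eigenvalue_root_char (allP rs) ?mem_nth.
  move=> b /sP bs; rewrite -(nth_index 0 bs) /i.
  case: arg_minP => // j _ /(_ (Ordinal (etrans (index_mem b s) bs)) isT); exact.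
suff -> : lambda_min M = a by [].
apply/eqP; rewrite eq_le; apply/andP; split; last first.
  by apply: lb_le_inf; [exists a | move=> b /amin].
by apply: ge_inf => //; exists a => b /amin.
Qed.
(* kermx is a left kernel: the rows of kermx A^T span the transposes of the
   columns x with A *m x = 0. *)
Definition orthonormal_null_basis (R : realType) (m n k : nat)
    (A : 'M[R]_(m, n)) (Z : 'M[R]_(n, k)) : Prop :=
  Z^T *m Z = 1%:M /\ (Z^T == kermx A^T)%MS.

Definition affine_set (R : realType) (m n : nat) (A : 'M[R]_(m, n))
    (b : 'cV[R]_m) : set 'cV[R]_n :=
  [set x | A *m x = b].

Definition polytope (R : realType) (m n p : nat) (A : 'M[R]_(m, n))
    (b : 'cV[R]_m) (C : 'M[R]_(p, n)) (d : 'cV[R]_p) (l u : 'cV[R]_n) :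
    set 'cV[R]_n :=
  [set x | [/\ A *m x = b,
               forall i, (C *m x) i 0 <= d i 0
             & forall i, l i 0 <= x i 0 <= u i 0]].

Section Relaxations.
Variables (R : realType) (n : nat) (Q : 'M[R]_n) (q l u : 'cV[R]_n).

Definition Qalpha (alpha : R) : 'M[R]_n := Q + alpha%:M.

Definition qalpha (alpha : R) : 'cV[R]_n := q - alpha *: (l + u).

Definition kalpha (alpha : R) : R := alpha * dotv l u.

(* The value lies in \bar R: it is +oo exactly when X is empty. *)
Definition relax_value (X : set 'cV[R]_n) (alpha : R) : \bar R :=
  ereal_inf [set (quadfun (Qalpha alpha) (qalpha alpha) (kalpha alpha) x)%:E
            | x in X].

Variables (J : finType) (S : J -> 'M[R]_n).

Definition Qalphabeta (alpha : R) (beta : J -> R) : 'M[R]_n :=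
  Qalpha alpha + \sum_(j : J) beta j *: S j.

Definition mu_EIGJ (X : set 'cV[R]_n) : \bar R :=
  ereal_sup [set relax_value X ab.1
            | ab in [set ab : R * (J -> R)
                    | 0 <= ab.1 /\ psdmx (Qalphabeta ab.1 ab.2)]].

End Relaxations.

Definition mu_EIGZ (R : realType) (n k : nat) (Q : 'M[R]_n) (q l u : 'cV[R]_n)
    (Z : 'M[R]_(n, k)) (X : set 'cV[R]_n) : \bar R :=
  relax_value Q q l u X (- lambda_min (Z^T *m Q *m Z)).

(* Main.v *)
Require Import Defs.
From mathcomp Require Import all_boot all_order all_algebra.
From mathcomp Require Import boolp classical_sets reals ereal.
From mathcomp Require Import ring.
Import Order.TTheory GRing.Theory Num.Theory.
Local Open Scope classical_set_scope.
Local Open Scope ring_scope.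

(** The penalty that [alpha] adds to the objective is [alpha] times the sum of
    the products [(x_i - l_i) * (x_i - u_i)], each of which is nonpositive on
    the box; hence the relaxation value is nonincreasing in [alpha]
    ([relax_value_nincr]).  It then suffices to see that every [alpha] admitted
    by the outer maximization is at least [- lambda_min (Z^T Q Z)]
    ([admissible_alpha_ge]).  Restricting the semidefinite constraint to the
    nullspace of [A], that is, conjugating it by [Z], kills every
    [S j = A^T W^T + W A], because [A Z = 0], so [beta] disappears; since
    [Z^T Z] is the identity, what remains says that [Z^T Q Z + alpha I] is
    positive semidefinite, which bounds the spectrum of [Z^T Q Z] below by
    [- alpha]. *)

Lemma null_basis_mul0 (R : realType) (m n k : nat)
    (A : 'M[R]_(m, n)) (Z : 'M[R]_(n, k)) :
  orthonormal_null_basis A Z -> A *m Z = 0.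
Proof.
case=> _ /andP[/sub_kermxP ZA0 _]; apply: trmx_inj.
by rewrite trmx_mul ZA0 trmx0.
Qed.

Lemma psdmx_congr (R : realType) (n k : nat) (M : 'M[R]_n) (Z : 'M[R]_(n, k)) :
  psdmx M -> psdmx (Z^T *m M *m Z).
Proof.
case=> symM M_ge0; split; first by rewrite !trmx_mul trmxK symM mulmxA.
by move=> x; have := M_ge0 (Z *m x); rewrite /qform trmx_mul !mulmxA.
Qed.

Lemma psdmx_eigenvalue_ge0 (R : realType) (n : nat) (M : 'M[R]_n) (a : R) :
  psdmx M -> eigenvalue M a -> 0 <= a.
Proof.
move=> [_ M_ge0] /eigenvalueP[v vM v0].
have := M_ge0 v^T; rewrite /qform trmxK vM -scalemxAl mxE pmulr_lge0 //.
have vv i : 0 <= v 0 i * v^T i 0 by rewrite mxE -expr2 sqr_ge0.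
rewrite mxE lt_neqAle sumr_ge0 // andbT eq_sym psumr_eq0 //.
apply: contra v0 => /allP v0; apply/eqP/rowP => i.
have := v0 i (mem_index_enum _).
by rewrite !mxE mulf_eq0 orbb => /eqP.
Qed.

Lemma eigenvalue_add_scalar (R : realType) (n : nat) (M : 'M[R]_n) (a c : R) :
  eigenvalue M a -> eigenvalue (M + c%:M) (a + c).
Proof.
move=> /eigenvalueP[v vM v0]; apply/eigenvalueP; exists v => //.
by rewrite mulmxDr vM mul_mx_scalar scalerDl.
Qed.

(** Functions of the form [x^T (A^T W^T + W A) x] vanish on the nullspace
    of [A], so only the shift by [alpha] survives the conjugation by [Z]. *)
Lemma null_basis_Qalphabeta (R : realType) (m n k : nat) (Q : 'M[R]_n)
    (A : 'M[R]_(m, n)) (Z : 'M[R]_(n, k)) (J : finType) (S : J -> 'M[R]_n)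
    (alpha : R) (beta : J -> R) :
  orthonormal_null_basis A Z ->
  (forall j, exists W : 'M[R]_(n, m), S j = A^T *m W^T + W *m A) ->
  Z^T *m Qalphabeta Q S alpha beta *m Z = Z^T *m Q *m Z + alpha%:M.
Proof.
move=> AZ SW; have AZ0 : A *m Z = 0 by exact: null_basis_mul0.
have [ZZ _] := AZ.
have ZSZ j : Z^T *m S j *m Z = 0.
  have [W ->] := SW j.
  rewrite mulmxDr mulmxDl !mulmxA -trmx_mul AZ0 trmx0 !mul0mx.
  by rewrite -!mulmxA AZ0 !mulmx0 addr0.
rewrite /Qalphabeta /Qalpha !mulmxDr !mulmxDl.
rewrite mul_mx_scalar -scalemxAl ZZ scalemx1 mulmx_sumr mulmx_suml.
rewrite big1 ?addr0 // => j _.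
by rewrite -scalemxAr -scalemxAl ZSZ scaler0.
Qed.

Lemma admissible_alpha_ge (R : realType) (m n k : nat) (Q : 'M[R]_n)
    (A : 'M[R]_(m, n)) (Z : 'M[R]_(n, k)) (J : finType) (S : J -> 'M[R]_n)
    (alpha : R) (beta : J -> R) :
  (0 < k)%N -> Q^T = Q -> orthonormal_null_basis A Z ->
  (forall j, exists W : 'M[R]_(n, m), S j = A^T *m W^T + W *m A) ->
  psdmx (Qalphabeta Q S alpha beta) ->
  - lambda_min (Z^T *m Q *m Z) <= alpha.
Proof.
move=> k_gt0 symQ AZ SW /psdmx_congr-/(_ _ Z).
rewrite (null_basis_Qalphabeta _ _ _ _ _ A) // => psdZ.
have symZ : (Z^T *m Q *m Z)^T = Z^T *m Q *m Z.
  by rewrite !trmx_mul trmxK symQ mulmxA.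
have [eig _] := lambda_min_is_min k_gt0 symZ.
rewrite -subr_ge0 opprK addrC.
by apply: psdmx_eigenvalue_ge0 psdZ _; apply: eigenvalue_add_scalar.
Qed.

(** Completing the [alpha] terms into a product per coordinate makes their sign
    on the box visible. *)
Lemma quadfun_alphaE (R : realType) (n : nat) (Q : 'M[R]_n)
    (q l u x : 'cV[R]_n) (alpha : R) :
  quadfun (Qalpha Q alpha) (qalpha q l u alpha) (kalpha l u alpha) x
    = quadfun Q q 0 x
      + alpha * \sum_i (x i 0 - l i 0) * (x i 0 - u i 0).
Proof.
have -> : \sum_i (x i 0 - l i 0) * (x i 0 - u i 0)
    = dotv x x - dotv (l + u) x + dotv l u.
  rewrite /dotv !mxE -sumrB -big_split /=; apply: eq_bigr => i _.
  by rewrite !mxE; ring.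
rewrite /quadfun /kalpha.
have -> : qform (Qalpha Q alpha) x = qform Q x + alpha * dotv x x.
  rewrite /qform /Qalpha mulmxDr mulmxDl mul_mx_scalar -scalemxAl.
  by rewrite mxE [X in _ + X]mxE.
have -> : dotv (qalpha q l u alpha) x = dotv q x - alpha * dotv (l + u) x.
  by rewrite /dotv /qalpha linearB linearZ /= mulmxBl -scalemxAl !mxE.
ring.
Qed.

Lemma relax_value_nincr (R : realType) (n : nat) (Q : 'M[R]_n)
    (q l u : 'cV[R]_n) (X : set 'cV[R]_n) (alpha alpha' : R) :
  (forall x, X x -> forall i, l i 0 <= x i 0 <= u i 0) ->
  alpha <= alpha' ->
  (relax_value Q q l u X alpha' <= relax_value Q q l u X alpha)%E.
Proof.
move=> Xbox le_alpha; apply: le_ereal_inf_tmp => _ [x Xx <-].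
apply: ge_ereal_inf.
exists (quadfun (Qalpha Q alpha') (qalpha q l u alpha')
          (kalpha l u alpha') x)%:E; first by exists x.
rewrite lee_fin !quadfun_alphaE lerD2l ler_wnM2r //.
apply: sumr_le0 => i _; have /andP[lx xu] := Xbox x Xx i.
by rewrite mulr_ge0_le0 ?subr_ge0 ?subr_le0.
Qed.

Theorem theorem1 (R : realType) (n m p k : nat)
    (Q : 'M[R]_n) (q : 'cV[R]_n)
    (A : 'M[R]_(m, n)) (b : 'cV[R]_m) (C : 'M[R]_(p, n)) (d : 'cV[R]_p)
    (l u : 'cV[R]_n) (Z : 'M[R]_(n, k))
    (J : finType) (S : J -> 'M[R]_n) (s : J -> 'cV[R]_n) (eta : J -> R) :
  Q^T = Q ->
  (forall i, l i 0 < u i 0) ->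
  orthonormal_null_basis A Z ->
  indefinitemx (Z^T *m Q *m Z) ->
  (forall j, (S j)^T = S j) ->
  (forall j x, affine_set A b x -> quadfun (S j) (s j) (eta j) x = 0) ->
  (forall j, exists W : 'M[R]_(n, m), S j = A^T *m W^T + W *m A) ->
  (mu_EIGJ Q q l u S (polytope A b C d l u)
     <= mu_EIGZ Q q l u Z (polytope A b C d l u))%E.
Proof.
move=> symQ _ AZ [[x Qx] _] _ _ SW.
(* For k = 0 there is no eigenvalue and lambda_min is the infimum of the empty
   set; indefiniteness excludes that case. *)
have k_gt0 : (0 < k)%N.
  case: k Z AZ x Qx => // Z _ x.
  by rewrite /qform mxE big_ord0 ltxx.
apply: ge_ereal_sup => _ [[alpha beta] [_ psd] <-] /=.
apply: relax_value_nincr; first by move=> y [].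
exact: admissible_alpha_ge k_gt0 symQ AZ SW psd.
Qed.
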